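(* Let $G,H$ be finite simple connected graphs, $K\in\{G,H\}$ with $\bar K$ the other graph, and fix a root $(r_G,r_H)\in V(G\,\square\,H)$. Then every configuration $c$ on $G\,\square\,H$ that is unsolvable for this root (no sequence of pebbling moves from $c$ places a pebble on $(r_G,r_H)$) satisfies \[ \sum_{j\in V(\bar K)} set_{K,j}+1\ \le\ \pi(\bar K). \]
   Context: The Cartesian product $G\,\square\,H$ has vertex set $V(G)\times V(H)$, with $(g,h)\sim(g',h')$ iff ($g=g'$ and $h\sim_H h'$) or ($h=h'$ and $g\sim_G g'$). A configuration on a graph $X$ is a function $c:V(X)\to\mathbb{Z}_{\ge 0}$; its size is $\sum_v c(v)$. A pebbling move removes two pebbles from one vertex and adds one pebble to an adjacent vertex. The pebbling number $\pi(X)$ is the least $k$ such that from every configuration of size $k$ on $X$ and every root $r$ some sequence of pebbling moves places a pebble on $r$. For $K\in\{G,H\}$, $\bar K$ is the other graph. For $j\in V(\bar K)$ the $K$-slice $K_j$ is $\{(i,j):i\in V(G)\}$ if $K=G$, and $\{(j,h):h\in V(H)\}$ if $K=H$. For a configuration $c$, $\tilde c_{K,j}=\sum_{u\in K_j}c(u)$ and $set_{K,j}=\lfloor\tilde c_{K,j}/\pi(K)\rfloor$. *)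

(* Defs.v *)
From mathcomp Require Import all_boot.
From mathcomp Require Import boolp.

Set Implicit Arguments.
Unset Strict Implicit.
Unset Printing Implicit Defensive.

Record sgraph := SGraph {
  vertex :> finType;
  adj : rel vertex;
  adj_sym : symmetric adj;
  adj_irrefl : irreflexive adj
}.

Definition connected_graph (X : sgraph) : Prop :=
  forall x y : X, connect (@adj X) x y.

Section CartesianProduct.
Variables G H : sgraph.

Definition cart_adj : rel (G * H) := fun u v =>
  ((u.1 == v.1) && adj u.2 v.2) || ((u.2 == v.2) && adj u.1 v.1).

Lemma cart_adj_sym : symmetric cart_adj.
Proof.
move=> u v; rewrite /cart_adj (eq_sym u.1) (eq_sym u.2).
by rewrite (adj_sym u.1) (adj_sym u.2).
Qed.

Lemma cart_adj_irrefl : irreflexive cart_adj.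
Proof. by move=> u; rewrite /cart_adj !adj_irrefl !andbF. Qed.

Definition cart : sgraph := SGraph cart_adj_sym cart_adj_irrefl.

End CartesianProduct.

Definition config (X : sgraph) : Type := {ffun X -> nat}.

Definition csize (X : sgraph) (c : config X) : nat := \sum_(v : X) c v.

Definition pebble (X : sgraph) (c : config X) (u v : X) : config X :=
  [ffun w => c w - (w == u).*2 + (w == v)].

Definition pebbling_move (X : sgraph) : rel (config X) := fun c c' =>
  [exists u : X, exists v : X, [&& adj u v, 1 < c u & c' == pebble c u v]].

Definition solvable (X : sgraph) (c : config X) (r : X) : Prop :=
  exists s : seq (config X), path (@pebbling_move X) c s /\ 0 < last c s r.

Definition pebbling_bound (X : sgraph) (k : nat) : Prop :=
  forall (c : config X) (r : X), csize c = k -> solvable c r.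

(* The value 0 for a graph without any such k is never used on a connected
   graph: see pebbling_numberP. *)
Definition pebbling_number (X : sgraph) : nat :=
  if pselect (exists k, `[< pebbling_bound X k >]) is left ex
  then ex_minn ex else 0.

Section PebblingNumberExists.
Variable X : sgraph.
Implicit Types (c : config X) (u v r : X).

Lemma pebbling_moveP c u v : adj u v -> 1 < c u ->
  pebbling_move c (pebble c u v).
Proof.
by move=> uv cu; apply/existsP; exists u; apply/existsP; exists v; apply/and3P.
Qed.

Lemma move_many u v m c : adj u v -> m.*2 <= c u ->
  exists s, path (@pebbling_move X) c s /\ m <= last c s v.
Proof.
move=> uv; have nvu : (v == u) = false.
  by apply/eqP => vu; rewrite vu adj_irrefl in uv.
suff: m.*2 <= c u ->
    exists s, path (@pebbling_move X) c s /\ m + c v <= last c s v.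
  move=> IH /IH [s [ps ls]]; exists s; split => //.
  exact: leq_trans (leq_addr _ _) ls.
elim: m c => [|m IHm] c; first by exists [::]; rewrite /= add0n.
rewrite doubleS => cu.
have [|s [ps ls]] := IHm (pebble c u v).
  by rewrite ffunE eqxx eq_sym nvu addn0 leq_subRL ?(leq_trans _ cu).
exists (pebble c u v :: s); split => /=.
  by rewrite ps andbT pebbling_moveP // (leq_trans _ cu).
by move: ls; rewrite ffunE nvu eqxx /= subn0 addn1 addnS.
Qed.

Lemma solvable_path p : forall c u, path (@adj X) u p -> 2 ^ size p <= c u ->
  solvable c (last u p).
Proof.
elim: p => [|v p IHp] c u /=; first by move=> _ cu; exists [::].
case/andP=> uv pv; rewrite expnS mul2n => cu.
have [s [ps ls]] := move_many uv cu.
have [s' [ps' ls']] := IHp _ _ pv ls.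
by exists (s ++ s'); rewrite cat_path last_cat ps.
Qed.

Lemma pebbling_bound_exists : connected_graph X ->
  exists k, pebbling_bound X k.
Proof.
move=> cX; exists (#|X| * 2 ^ #|X|) => c r cs.
have [/existsP [u cu]|/existsPn no] := boolP [exists u, 2 ^ #|X| <= c u].
  have /connectP [p pp ->] := cX u r.
  case/shortenP: pp => q pq uq _; apply: solvable_path pq _.
  apply: leq_trans cu; rewrite leq_exp2l //.
  have := max_card (mem (u :: q)); rewrite (card_uniqP uq); exact: ltnW.
suff: csize c < #|X| * 2 ^ #|X| by rewrite cs ltnn.
have X0 : 0 < #|X| by apply/card_gt0P; exists r.
apply: (@leq_ltn_trans (\sum_(v : X) (2 ^ #|X|).-1)).
  by apply: leq_sum => v _; rewrite -ltnS prednK ?expn_gt0 // ltnNge no.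
by rewrite sum_nat_const ltn_pmul2l // prednK ?expn_gt0.
Qed.

Lemma pebbling_numberP : connected_graph X ->
  pebbling_bound X (pebbling_number X) /\
  forall k, pebbling_bound X k -> pebbling_number X <= k.
Proof.
move=> /pebbling_bound_exists [k0 bk0]; rewrite /pebbling_number.
case: pselect => [ex|[]]; last by exists k0; apply/asboolP.
case: ex_minnP => m /asboolP bm min_m; split => // k bk.
by apply: min_m; apply/asboolP.
Qed.

End PebblingNumberExists.

Variant factor := FactorG | FactorH.

Definition factor_graph (G H : sgraph) (K : factor) : sgraph :=
  match K with FactorG => G | FactorH => H end.

Definition cofactor_graph (G H : sgraph) (K : factor) : sgraph :=
  match K with FactorG => H | FactorH => G end.

Definition slice (G H : sgraph) (K : factor) :
    cofactor_graph G H K -> {set cart G H} :=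
  match K return cofactor_graph G H K -> {set cart G H} with
  | FactorG => fun j : H => [set u : G * H | u.2 == j]
  | FactorH => fun j : G => [set u : G * H | u.1 == j]
  end.

Definition slice_size (G H : sgraph) (c : config (cart G H)) (K : factor)
    (j : cofactor_graph G H K) : nat :=
  \sum_(u in slice j) c u.

Definition slice_sets (G H : sgraph) (c : config (cart G H)) (K : factor)
    (j : cofactor_graph G H K) : nat :=
  slice_size c j %/ pebbling_number (factor_graph G H K).

(* Main.v *)
(** If at least [pi (cofactor)] sets were available, each [K]-slice [j] could
    send [set_j] pebbles to its copy of the root of [K], one for every disjoint
    block of [pi K] pebbles.  The slice of the cofactor through that root would
    then carry [pi (cofactor)] pebbles, enough to reach the root of the product.
    Reachability is taken up to discarding pebbles, so that it is compatible
    with sums of configurations and with images under graph homomorphisms. *)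

Require Import Defs.
From mathcomp Require Import all_boot ssralg.

Set Implicit Arguments.
Unset Strict Implicit.
Unset Printing Implicit Defensive.

Import GRing.Theory.

Section Reachability.
Variable X : sgraph.
Implicit Types (c d e f : {ffun X -> nat}) (u v r : X).

Definition single v : {ffun X -> nat} := [ffun w => (w == v) : nat].

(** A move is written additively around an untouched remainder [f]: this form encodes that [u] holds
    two pebbles and avoids the truncated subtraction of [pebble]. *)
Inductive reaches : {ffun X -> nat} -> {ffun X -> nat} -> Prop :=
| reaches_discard d f : reaches (d + f)%R d
| reaches_move u v f d : adj u v -> reaches (f + single v)%R d ->
    reaches (f + single u *+ 2)%R d.

Lemma config_addE c d v : (c + d)%R v = c v + d v.
Proof. by rewrite ffunE. Qed.

Lemma config_mulrnE c n v : (c *+ n)%R v = c v * n.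
Proof. by elim: n => [|n IH]; rewrite ?mulr0n ?mulrS ?ffunE /= ?muln0 ?IH // mulnS. Qed.

Lemma config_sum_single c : c = (\sum_v single v *+ c v)%R.
Proof.
apply/ffunP => w; rewrite sum_ffunE (bigD1 w) //= big1 => [|v vw].
  by rewrite config_mulrnE ffunE eqxx mul1n addr0.
by rewrite config_mulrnE ffunE eq_sym (negPf vw).
Qed.

Lemma reaches_refl c : reaches c c.
Proof. by rewrite -{1}[c]addr0; apply: reaches_discard. Qed.

Lemma reaches_addr c d f : reaches c d -> reaches (c + f)%R (d + f)%R.
Proof.
elim=> {c d} [d g|u v g d uv _ IH]; first by rewrite addrAC; apply: reaches_discard.
by rewrite addrAC; apply: (reaches_move uv); rewrite addrAC.
Qed.

Lemma reaches_extra c d f : reaches c d -> reaches (c + f)%R d.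
Proof.
elim=> {c d} [d g|u v g d uv _ IH]; first by rewrite -addrA; apply: reaches_discard.
by rewrite addrAC; apply: (reaches_move uv); rewrite addrAC.
Qed.

Lemma reaches_trans c d e : reaches c d -> reaches d e -> reaches c e.
Proof.
elim=> {c d} [d f|u v f d uv _ IH] de; first exact: reaches_extra.
by apply: (reaches_move uv); apply: IH.
Qed.

Lemma reaches_add c c' d d' :
  reaches c d -> reaches c' d' -> reaches (c + c')%R (d + d')%R.
Proof.
move=> cd cd'; apply: reaches_trans (reaches_addr c' cd) _.
by rewrite addrC [(d + d')%R]addrC; apply: reaches_addr.
Qed.

Lemma reaches_sum (I : finType) (F F' : I -> {ffun X -> nat}) :
  (forall i, reaches (F i) (F' i)) -> reaches (\sum_i F i)%R (\sum_i F' i)%R.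
Proof.
move=> FF'; apply: (big_ind2 reaches) => //; first exact: reaches_refl.
by move=> *; apply: reaches_add.
Qed.

Lemma pebble_addE u v f : pebble (f + single u *+ 2)%R u v = (f + single v)%R.
Proof.
by apply/ffunP => w; rewrite ffunE config_addE config_mulrnE config_addE !ffunE muln2 addnK.
Qed.

Lemma subconfigP c d : (forall v, d v <= c v) -> {f | c = (d + f)%R}.
Proof.
move=> dc; exists [ffun v => c v - d v]; apply/ffunP => v.
by rewrite config_addE ffunE subnKC.
Qed.

(** A final pebble on [r] splits off as [single r] and the rest is discarded. Conversely, a
    derivation of [reaches] lists its moves, and a configuration that discards down to [single r]
    has a pebble on [r]. *)
Lemma solvable_reaches c r : solvable c r <-> reaches c (single r).
Proof.
split=> [[s [ps ls]]|].
  elim: s c ps ls => [|c' s IH] c /= => [_ cr|/andP[mv ps] ls].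
    have [v|f ->] := @subconfigP c (single r); last exact: reaches_discard.
    by rewrite ffunE; case: eqP => // ->.
  case/existsP: mv => u /existsP[v /and3P[uv cu /eqP c'E]].
  have [w|f cE] := @subconfigP c (single u *+ 2)%R.
    by rewrite config_mulrnE ffunE; case: eqP => // ->.
  have {}cE : c = (f + single u *+ 2)%R by rewrite cE addrC.
  rewrite cE; apply: (reaches_move uv).
  by move: (IH c' ps ls); rewrite c'E cE pebble_addE.
move: {-1}(single r) (erefl (single r)) => d dE cd.
elim: cd dE => {c d} [d f <-|u v f d uv _ IH /IH [s [ps ls]]].
  by exists [::]; rewrite /= !ffunE eqxx.
exists ((f + single v)%R :: s); split=> //=; rewrite ps andbT -(pebble_addE u).
by apply: pebbling_moveP uv _; rewrite config_addE config_mulrnE ffunE eqxx mul1n leq_addl.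
Qed.

Lemma csizeD c d : csize (c + d)%R = csize c + csize d.
Proof. by rewrite /csize -big_split; apply: eq_bigr => v _; rewrite config_addE. Qed.

Lemma csize_single v : csize (single v) = 1.
Proof.
rewrite /csize (bigD1 v) //= ffunE eqxx big1 // => w wv.
by rewrite ffunE (negPf wv).
Qed.

(** [pebbling_bound] speaks of configurations of one exact size, so blocks of exactly that size are
    cut off, pebble by pebble. *)
Lemma split_config k c : k <= csize c ->
  exists d f, c = (d + f)%R /\ csize d = k.
Proof.
elim: k => [_|k IH kc].
  exists 0%R, c; rewrite add0r; split=> //.
  by rewrite /csize big1 // => v _; rewrite ffunE.
have [d [f [cE dk]]] := IH (ltnW kc).
(* [c] has more than [k] pebbles and [d] takes only [k] of them. *)
have [v fv] : exists v, 0 < f v.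
  apply/existsP; apply: contraLR kc => /existsPn f0.
  rewrite -leqNgt cE csizeD dk [csize f]big1 ?addn0 // => v _.
  by apply/eqP; rewrite -leqn0 leqNgt f0.
have [w|g fE] := @subconfigP f (single v).
  by rewrite ffunE; case: eqP => // ->.
exists (d + single v)%R, g; rewrite cE fE addrA; split=> //.
by rewrite csizeD csize_single dk addn1.
Qed.

(** Induction on [n]: one block of [pebbling_number X] pebbles delivers a pebble to [r], and the
    disjoint remainder is large enough to deliver the others. *)
Lemma reaches_many n c r : connected_graph X ->
  n * pebbling_number X <= csize c -> reaches c (single r *+ n)%R.
Proof.
move=> /pebbling_numberP[bX _]; elim: n c => [|n IH] c nc.
  by rewrite mulr0n -[c]add0r; apply: reaches_discard.
have [|d [f [cE dk]]] := @split_config (pebbling_number X) c.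
  by apply: leq_trans nc; rewrite mulSn leq_addr.
rewrite cE mulrS; apply: reaches_add; first exact/solvable_reaches/bX.
by apply: IH; rewrite -(leq_add2l (pebbling_number X)) -mulSn -{2}dk -csizeD -cE.
Qed.

End Reachability.

Section Image.
Variables (X Y : sgraph) (phi : X -> Y).
Implicit Types c d : {ffun X -> nat}.

(** The pushforward of [c] along [phi]: pebbles in one fibre pile up on its image. *)
Definition image_config c : {ffun Y -> nat} :=
  (\sum_x single (phi x) *+ c x)%R.

Lemma image_configD c d :
  image_config (c + d)%R = (image_config c + image_config d)%R.
Proof.
rewrite /image_config -big_split; apply: eq_bigr => x _.
by rewrite config_addE mulrnDr.
Qed.

Lemma image_config_single x : image_config (single x) = single (phi x).
Proof.
rewrite /image_config (bigD1 x) //= ffunE eqxx mulr1n big1 ?addr0 // => y yx.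
by rewrite ffunE (negPf yx) mulr0n.
Qed.

Lemma image_config_mulrn x n :
  image_config (single x *+ n)%R = (single (phi x) *+ n)%R.
Proof.
elim: n => [|n IH]; last by rewrite !mulrS image_configD image_config_single IH.
by rewrite !mulr0n /image_config big1 // => y _; rewrite ffunE mulr0n.
Qed.

(** Each move runs along an edge, which [phi] sends to an edge, and the pushforward is additive. *)
Lemma reaches_image c d : {homo phi : u v / adj u v} ->
  reaches c d -> reaches (image_config c) (image_config d).
Proof.
move=> hphi; elim=> {c d} [d f|u v f d uv _ IH].
  by rewrite image_configD; apply: reaches_discard.
rewrite image_configD image_config_mulrn; apply: (reaches_move (hphi _ _ uv)).
by rewrite -image_config_single -image_configD.
Qed.

End Image.

(** [A] plays [K] and [B] its cofactor. With [phi] abstract, the identity and the coordinate swap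
    yield both choices of [K]. *)
Lemma sum_slice_sets_lt (A B Y : sgraph) (phi : A * B -> Y) (a : A) (b : B)
    (c : {ffun Y -> nat}) :
  bijective phi ->
  (forall j, {homo (fun i => phi (i, j)) : u v / adj u v}) ->
  (forall i, {homo (fun j => phi (i, j)) : u v / adj u v}) ->
  connected_graph A -> connected_graph B -> ~ solvable c (phi (a, b)) ->
  \sum_j (\sum_i c (phi (i, j))) %/ pebbling_number A < pebbling_number B.
Proof.
move=> bphi homA homB cA cB unsolv; rewrite ltnNge; apply/negP => many.
apply/unsolv/solvable_reaches.
pose cs j : {ffun A -> nat} := [ffun i => c (phi (i, j))].
pose n : {ffun B -> nat} := [ffun j => csize (cs j) %/ pebbling_number A].
(* Since [phi] is bijective, [c] is the sum of its slices, each pushed forward from a copy of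
   [A]. *)
have cE : c = (\sum_j image_config (fun i => phi (i, j)) (cs j))%R.
  rewrite [LHS]config_sum_single (reindex phi) /=; last exact: onW_bij.
  rewrite exchange_big pair_bigA /=; apply: eq_bigr => -[i j] _.
  by rewrite ffunE.
have rn : reaches c (image_config (fun j => phi (a, j)) n).
  rewrite [X in reaches X _]cE; apply: reaches_sum => j.
  (* The [n j] pebbles on [phi (a, j)] are now seen inside slice [j], as the image of [n j] pebbles
     on the root [a] of [A]. *)
  rewrite -(image_config_mulrn (fun i => phi (i, j))).
  apply: reaches_image => //; apply: reaches_many => //.
  by rewrite ffunE leq_trunc_div.
apply: reaches_trans rn _.
(* In the copy of [B] through [a], the configuration [n] has at least [pebbling_number B] pebbles by
   [many], so one reaches [b]. *)
rewrite -(image_config_single (fun j => phi (a, j))); apply: reaches_image => //.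
rewrite -[single b]mulr1n; apply: reaches_many => //; rewrite mul1n.
apply: leq_trans many _; apply: eq_leq; apply: eq_bigr => j _.
by rewrite ffunE; congr (_ %/ _); apply: eq_bigr => i _; rewrite ffunE.
Qed.

Theorem theorem1 (G H : sgraph) (K : factor) (rG : G) (rH : H)
    (c : config (cart G H)) :
  connected_graph G -> connected_graph H ->
  ~ solvable c ((rG, rH) : cart G H) ->
  (\sum_(j : cofactor_graph G H K) slice_sets c j) + 1
    <= pebbling_number (cofactor_graph G H K).
Proof.
move=> cG cH unsolv; rewrite addn1; case: K => /=.
- have := @sum_slice_sets_lt G H (cart G H) id rG rH c.
  move=> /(_ _ _ _ cG cH unsolv) lt.
  apply: leq_ltn_trans (lt _ _ _) => [|||]; first last.
  + by move=> i u v uv; rewrite /= /cart_adj eqxx uv.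
  + by move=> j u v uv; rewrite /= /cart_adj eqxx uv orbT.
  + by exists id.
  apply: eq_leq; apply: eq_bigr => j _; congr (_ %/ _).
  (* The slice is a set of pairs; splitting the pair sum leaves only the second coordinate [j]. *)
  transitivity (\sum_(u : G * H | predT u.1 && pred1 j u.2) c (u.1, u.2)).
    by apply: eq_big => [u|[]//]; rewrite inE.
  rewrite -(pair_big predT (pred1 j) (fun i k => c (i, k))) /=.
  by apply: eq_bigr => i _; rewrite big_pred1_eq.
(* The swap puts the factor [H] in the role of [A]. *)
- pose swap (u : H * G) : cart G H := (u.2, u.1).
  have := @sum_slice_sets_lt H G (cart G H) swap rH rG c.
  move=> /(_ _ _ _ cH cG unsolv) lt.
  apply: leq_ltn_trans (lt _ _ _) => [|||]; first last.
  + by move=> i u v uv; rewrite /= /cart_adj eqxx uv orbT.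
  + by move=> j u v uv; rewrite /= /cart_adj eqxx uv.
  + by exists (fun u => (u.2, u.1)); case.
  apply: eq_leq; apply: eq_bigr => j _; congr (_ %/ _).
  transitivity (\sum_(u : G * H | pred1 j u.1 && predT u.2) c (u.1, u.2)).
    by apply: eq_big => [u|[]//]; rewrite inE andbT.
  by rewrite -(pair_big (pred1 j) predT (fun k i => c (k, i))) big_pred1_eq.
Qed.
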